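(* Let $n\in\mathbb{N}$ and let $\eta_1,\ldots,\eta_{2n}$ be independent standard Gaussian random variables. Then $$\mathbb{E}\,\max\{\eta_1,\dots,\eta_{2n}\}\leq \mathbb{E}\,\max\{|\eta_1|,\dots,|\eta_n|\}\leq \sqrt{\frac{2n}{2n-1}}\, \mathbb{E}\,\max\{\eta_1,\dots,\eta_{2n}\}.$$ *)

(* Defs.v *)
From HB Require Import structures.
From mathcomp Require Import all_boot all_order all_algebra.
From mathcomp Require Import all_classical all_reals all_analysis.
Set Implicit Arguments. Unset Strict Implicit. Unset Printing Implicit Defensive.
Import Order.TTheory GRing.Theory Num.Theory.
Local Open Scope classical_set_scope.
Local Open Scope ring_scope.

Definition mutually_independent d (T : measurableType d) (R : realType)
  (P : probability T R) (m : nat) (X : nat -> {RV P >-> R}) : Prop :=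
  forall (J : {set 'I_m}) (A : 'I_m -> set R),
    (forall i, measurable (A i)) ->
    P (\big[setI/setT]_(i in J) (X i @^-1` A i)) =
    (\prod_(i in J) P (X i @^-1` A i))%E.

Definition standard_gaussian d (T : measurableType d) (R : realType)
  (P : probability T R) (X : {RV P >-> R}) : Prop :=
  forall A : set R, measurable A -> distribution P X A = normal_prob 0 1 A.

Definition Emax d (T : measurableType d) (R : realType)
  (P : probability T R) (m : nat) (f : nat -> T -> R) : \bar R :=
  (\int[P]_w (\big[Order.max/-oo]_(0 <= i < m) (f i w)%:E))%E.

Arguments mutually_independent {d T R} P m X.
Arguments standard_gaussian {d T R} P X.
Arguments Emax {d T R} P m f.

(* Main.v *)
Require Import Defs.
From HB Require Import structures.
From mathcomp Require Import all_boot all_order all_algebra.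
From mathcomp Require Import all_classical all_reals all_analysis.
From mathcomp Require Import measurable_realfun ring lra zify.
Import Order.TTheory GRing.Theory Num.Theory.
Import numFieldNormedType.Exports.
Set Implicit Arguments. Unset Strict Implicit. Unset Printing Implicit Defensive.
Local Open Scope ring_scope.

(** Let [Phi] be the standard normal distribution function. By independence and
    the tail formula, the two expectations are the integrals over [0, +oo[ of
    [1 - Phi ^+ 2n - (1 - Phi) ^+ 2n] and of [1 - (2 Phi - 1) ^+ n]. The lower
    bound follows from [2 Phi - 1 <= Phi ^+ 2]. For [n >= 2] the upper bound
    already holds between the integrands: with [q = 1 - Phi], the difference
    [(1 - q) ^+ 2n - (1 - 2q) ^+ n] is at most [n q ^+ 2 (1 - q) ^+ (2n - 2)],
    which is controlled by the first terms of the binomial expansion of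
    [((1 - q) + q) ^+ 2n]. For [n = 1] the integrands are not comparable, but
    both integrals have explicit antiderivatives and the bound is an equality. *)

(** * Polynomial inequalities between the two tail integrands *)

Section algebra.
Context {R : rcfType}.
Implicit Types (a b p q u : R) (n k : nat).

(** The difference of powers is [a - b] times a sum of [n.+1] monomials of degree [n], each at most
    [a ^+ n]. *)
Lemma subrXX_le a b n : 0 <= b -> b <= a ->
  a ^+ n.+1 - b ^+ n.+1 <= n.+1%:R * (a - b) * a ^+ n.
Proof.
move=> b0 ba; have a0 := le_trans b0 ba.
elim: n => [|n IHn]; first by rewrite expr0 !expr1 mul1r mulr1.
have an0 : 0 <= a ^+ n by exact: exprn_ge0.
have bX : b ^+ n.+1 <= a ^+ n.+1 by apply: lerXn2r.
have -> : a ^+ n.+2 - b ^+ n.+2 =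
    a * (a ^+ n.+1 - b ^+ n.+1) + (a - b) * b ^+ n.+1.
  by rewrite !exprS; ring.
have -> : n.+2%:R * (a - b) * a ^+ n.+1 =
    a * (n.+1%:R * (a - b) * a ^+ n) + (a - b) * a ^+ n.+1.
  by rewrite -[n.+2%:R]natr1 !exprS; ring.
by apply: lerD; apply: ler_wpM2l => //; rewrite subr_ge0.
Qed.

(* The terms of degree at most 4 in [q] of [(p + q) ^+ m], divided by
   [p ^+ (m - 4)]. *)
Let trunc_binom p q (m : R) := p ^+ 4 + m * q * p ^+ 3
  + m * (m - 1) / 2 * q ^+ 2 * p ^+ 2
  + m * (m - 1) * (m - 2) / 6 * q ^+ 3 * p
  + m * (m - 1) * (m - 2) * (m - 3) / 24 * q ^+ 4.

(** A partial sum of the nonnegative terms of [(p + q) ^+ (k + 4) = 1]. The induction multiplies by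
    [p + q], starting from the full expansion at exponent 4. *)
Lemma trunc_binom_le1 p q k : 0 <= p -> 0 <= q -> p + q = 1 ->
  p ^+ k * trunc_binom p q (k + 4)%:R <= 1.
Proof.
move=> p0 q0 pq1; elim: k => [|k IHk].
  rewrite expr0 mul1r add0n /trunc_binom.
  have -> : p = 1 - q by rewrite -pq1 addrK.
  by rewrite le_eqVlt; apply/orP; left; apply/eqP; field.
apply: le_trans IHk; rewrite -[leRHS]mul1r -[X in _ <= X * _]pq1.
have pk0 : 0 <= p ^+ k by exact: exprn_ge0.
rewrite /trunc_binom !natrD -[k.+1%:R]natr1 exprS; set x : R := k%:R.
have x0 : 0 <= x by exact: ler0n.
rewrite -subr_ge0; set d := (X in 0 <= X).
(* The only term lost by truncating again is the one of degree 5 in [q], with coefficient the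
   binomial of [k + 4] over 4. *)
have -> : d = p ^+ k * q ^+ 5 * ((x + 4) * (x + 3) * (x + 2) * (x + 1) / 24).
  by rewrite /d; field.
apply: mulr_ge0; first by apply: mulr_ge0 => //; exact: exprn_ge0.
by rewrite divr_ge0// !mulr_ge0// addr_ge0.
Qed.

(** To be used with [k + 6 = 2n]. Since [q <= p], every term is at most [p ^+ (k + 2)] times a
    quartic form in [p] and [q], which is compared with the truncated binomial. *)
Lemma max_tail_polynomial_le1 q k : 0 <= q -> q <= 1 / 2 ->
  (2 * (k + 6) + 1)%:R * q ^+ (k + 6) + (k + 6)%:R ^+ 2 * q ^+ 2 * (1 - q) ^+ (k + 4)
  + (1 - q) ^+ (k + 6) <= 1.
Proof.
move=> q0 q12; set p := 1 - q.
have p0 : 0 <= p by rewrite /p; lra.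
have qp : q <= p by rewrite /p; lra.
have := @trunc_binom_le1 p q (k + 2) p0 q0 (subrK _ _).
apply: le_trans; rewrite -addnA /=.
have pk0 : 0 <= p ^+ (k + 2) by exact: exprn_ge0.
have qk : q ^+ (k + 6) <= p ^+ (k + 2) * q ^+ 4.
  have -> : (k + 6 = (k + 2) + 4)%N by lia.
  by rewrite exprD ler_wpM2r ?exprn_ge0// lerXn2r.
have -> : p ^+ (k + 6) = p ^+ (k + 2) * p ^+ 4 by rewrite -exprD -addnA.
have -> : p ^+ (k + 4) = p ^+ (k + 2) * p ^+ 2 by rewrite -exprD -addnA.
set m : R := (k + 6)%:R; have m6 : 6 <= m by rewrite ler_nat leq_addl.
have -> : (2 * (k + 6) + 1)%:R = 2 * m + 1 :> R by rewrite natrD natrM.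
apply: (@le_trans _ _ (p ^+ (k + 2) *
  ((2 * m + 1) * q ^+ 4 + m ^+ 2 * q ^+ 2 * p ^+ 2 + p ^+ 4))).
  rewrite -subr_ge0; set d := (X in 0 <= X).
  have -> : d = (2 * m + 1) * (p ^+ (k + 2) * q ^+ 4 - q ^+ (k + 6)).
    by rewrite /d; ring.
  by apply: mulr_ge0; [lra|rewrite subr_ge0].
apply: ler_wpM2l => //; rewrite -subr_ge0; set d := (X in 0 <= X).
(* After [m * q * p] is factored out, the square in [p] is completed; the coefficient of [q ^+ 4] is
   expanded around [m = 6]. For [m >= 6] both remainders are visibly nonnegative. *)
have -> : d = m * q * p * ((p - (m + 1) / 4 * q) ^+ 2
      + q ^+ 2 * ((5 * (m - 6) * m + 13) / 48))
    + q ^+ 4 * ((m - 6) * ((m - 6) ^+ 3 + 18 * (m - 6) ^+ 2 + 119 * (m - 6) + 294)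
      / 24 + 2).
  by rewrite /d /trunc_binom; field.
have mge6 : 0 <= m - 6 by rewrite subr_ge0.
have m0 : 0 <= m by lra.
apply: addr_ge0.
  apply: mulr_ge0; first by rewrite !mulr_ge0.
  apply: addr_ge0; first exact: sqr_ge0.
  apply: mulr_ge0; first exact: sqr_ge0.
  by rewrite divr_ge0// addr_ge0// !mulr_ge0.
apply: mulr_ge0; first exact: exprn_ge0.
by rewrite addr_ge0// divr_ge0// mulr_ge0// !addr_ge0// ?mulr_ge0 ?exprn_ge0.
Qed.

(** A rational lower bound for the constant, checked by squaring. It suffices when the excess of the
    integrands is at most a fraction [1 / 4n] of the smaller one. *)
Lemma sqrt_ratio_ge n : (0 < n)%N ->
  1 + (4 * n)%:R^-1 <= Num.sqrt ((2 * n)%:R / (2 * n - 1)%:R) :> R.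
Proof.
move=> n0; rewrite natrB ?muln_gt0// !natrM; set x : R := n%:R.
have x1 : 1 <= x by rewrite ler1n.
have c0 : 0 <= 1 + (4 * x)^-1 by rewrite addr_ge0// invr_ge0; lra.
rewrite -(ger0_norm c0) -sqrtr_sqr ler_wsqrtr// -subr_ge0; set d := (X in 0 <= X).
have -> : d = (6 * x + 1) / (16 * x ^+ 2 * (2 * x - 1)).
  by rewrite /d; field; apply/andP; split; lra.
by rewrite divr_ge0 ?mulr_ge0 ?sqr_ge0//; lra.
Qed.

(* Multiplied by [4n], the excess of the left-hand side over
   [1 - u ^+ 2n - (1 - u) ^+ 2n] is at most that quantity, except for [n = 2]. *)
Lemma abs_max_tail_le n u : (1 < n)%N -> 1 / 2 <= u -> u <= 1 ->
  1 - (2 * u - 1) ^+ n <= Num.sqrt ((2 * n)%:R / (2 * n - 1)%:R)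
    * (1 - u ^+ (2 * n) - (1 - u) ^+ (2 * n)).
Proof.
move=> n1 u12 u1; case: n n1 => [|[|[|n]]]// _.
  (* For [n = 2] the bound [1 + 1 / 4n = 9 / 8] is too small: the two sides have ratio exactly
     [8 / 7] at [u = 1 / 2]. With [8 / 7] the difference acquires the factor [(2 * u - 1) ^+ 2]. *)
  have c87 : 8 / 7 <= Num.sqrt ((2 * 2)%:R / (2 * 2 - 1)%:R) :> R.
    have h87 : 0 <= 8 / 7 :> R by lra.
    rewrite -(ger0_norm h87) -sqrtr_sqr ler_wsqrtr// -subr_ge0.
    by rewrite natrB// natrM (_ : _ - _ = 4 / 147) ?divr_ge0//; field; lra.
  have q0 : 0 <= 1 - u by lra.
  apply: (@le_trans _ _ (8 / 7 * (1 - u ^+ (2 * 2) - (1 - u) ^+ (2 * 2)))).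
    rewrite -subr_ge0; set d := (X in 0 <= X).
    have -> : d = 4 / 7 * (1 - u) * u * (2 * u - 1) ^+ 2 by rewrite /d; field.
    by rewrite !mulr_ge0 ?sqr_ge0//; lra.
  apply: ler_wpM2r => //; set d := (X in 0 <= X).
  have -> : d = 2 * u * (1 - u) * (u ^+ 2 + (1 - u) ^+ 2 + 1 + u * (1 - u)) by rewrite /d; ring.
  have u0 : 0 <= u by lra.
  by rewrite !mulr_ge0// !addr_ge0 ?exprn_ge0// mulr_ge0.
(* From here on the exponent is [n.+3], so that [2 * n.+3 = 2 * n + 6] has the form required by
   [max_tail_polynomial_le1]. *)
set q := 1 - u; set N : R := n.+3%:R.
have q0 : 0 <= q by rewrite /q; lra.
have q12 : q <= 1 / 2 by rewrite /q; lra.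
have N0 : 0 < N by rewrite ltr0n.
have -> : u = 1 - q by rewrite /q; ring.
have -> : 2 * (1 - q) - 1 = 1 - 2 * q by ring.
set p := 1 - q; have p0 : 0 <= p by rewrite /p; lra.
have b0 : 0 <= 1 - 2 * q by lra.
have ba : 1 - 2 * q <= p ^+ 2.
  by rewrite -subr_ge0 (_ : _ - _ = q ^+ 2) ?sqr_ge0// /p; ring.
have := subrXX_le n.+2 b0 ba.
rewrite (_ : p ^+ 2 - (1 - 2 * q) = q ^+ 2); last by rewrite /p; ring.
have -> : (p ^+ 2) ^+ n.+3 = p ^+ (2 * n.+3) by rewrite -exprM.
have -> : (p ^+ 2) ^+ n.+2 = p ^+ (2 * n + 4).
  by rewrite -exprM; congr (_ ^+ _); lia.
rewrite -/N => diff.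
have := @max_tail_polynomial_le1 q (2 * n) q0 q12; rewrite -/p.
have -> : (2 * n + 6 = 2 * n.+3)%N by lia.
have -> : (2 * (2 * n.+3) + 1)%:R = 4 * N + 1 by rewrite mulnA natrD natrM.
move=> bound; rewrite natrM -/N in bound.
set g := 1 - _ - _.
(* The excess is [p ^+ (2 * n.+3) - (1 - 2 * q) ^+ n.+3 + q ^+ (2 * n.+3)], and [diff] bounds its
   first two terms. Of the [4 * N + 1] copies of the power of [q] in [bound], [4 * N] serve the
   excess and one serves [g]. *)
have fg : 4 * N * (1 - (1 - 2 * q) ^+ n.+3 - g) <= g.
  rewrite /g.
  have : 4 * N * (p ^+ (2 * n.+3) - (1 - 2 * q) ^+ n.+3)
      <= 4 * N * (N * q ^+ 2 * p ^+ (2 * n + 4)).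
    by rewrite ler_wpM2l// mulr_ge0// ltW.
  move: bound.
  set A := p ^+ (2 * n.+3); set B := (1 - 2 * q) ^+ _; set C := p ^+ _.
  set D := q ^+ (2 * _); set E := q ^+ 2; move=> h1 h2.
  have {}h1 : (4 * N + 1) * D + 4 * N * (N * E * C) + A <= 1.
    apply: le_trans h1; rewrite le_eqVlt; apply/orP; left; apply/eqP; ring.
  rewrite -subr_ge0; set d := (X in 0 <= X).
  have -> : d = (1 - ((4 * N + 1) * D + 4 * N * (N * E * C) + A)) +
    (4 * N * (N * E * C) - 4 * N * (A - B)) by rewrite /d; ring.
  by rewrite addr_ge0// subr_ge0.
have g0 : 0 <= g.
  rewrite /g -addrA -opprD subr_ge0.
  have -> : 1 = p ^+ 2 + q ^+ 2 + 2 * p * q :> R by rewrite /p; ring.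
  have h (x : R) : 0 <= x -> x <= 1 -> x ^+ (2 * n.+3) <= x ^+ 2.
    by move=> x0 x1; apply: ler_wiXn2l => //; lia.
  have := h p p0 _; have := h q q0 _ => h1 h2.
  rewrite ler_wpDr ?mulr_ge0// lerD//; [apply: h2|apply: h1]; rewrite /p; lra.
apply: (@le_trans _ _ ((1 + (4 * n.+3)%:R^-1) * g)); last first.
  by apply: ler_wpM2r => //; exact: sqrt_ratio_ge.
have N4 : 0 < 4 * N by rewrite mulr_gt0.
rewrite natrM -/N -(ler_pM2l N4).
have -> : 4 * N * ((1 + (4 * N)^-1) * g) = 4 * N * g + g by field; lra.
by move: fg; rewrite mulrBr; lra.
Qed.

End algebra.

(** * Improper integrals from antiderivatives *)

Section is_derive_extras.
Local Open Scope classical_set_scope.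
Context {R : realType}.
Implicit Types (f F : R -> R) (x : R).

Lemma is_derive_continuous F f : (forall x, is_derive x 1 F (f x)) -> continuous F.
Proof.
move=> dF x; apply/differentiable_continuous/derivable1_diffP.
by have [] := dF x.
Qed.

Lemma ge0_is_derive_FTC2y f F (a l : R) : (forall x, a <= x -> 0 <= f x) ->
  continuous f -> (forall x, is_derive x 1 F (f x)) -> F x @[x --> +oo] --> l ->
  (\int[@lebesgue_measure R]_(x in `[a, +oo[) (f x)%:E = (l - F a)%:E)%E.
Proof.
move=> f0 cf dF Fl; rewrite EFinB; apply: ge0_continuous_FTC2y => //.
- exact: continuous_subspaceT.
- exact/cvg_at_right_filter/(is_derive_continuous dF).
- by move=> x _; rewrite derive1E; have [] := dF x.
Qed.

End is_derive_extras.

(** * The standard normal distribution function and two explicit integrals *)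

Section normal_cdf.
Local Open Scope classical_set_scope.
Context {R : realType}.
Implicit Types t x : R.
Local Notation mu := (@lebesgue_measure R).
Local Notation phi := (@normal_pdf R 0 1).
Local Notation peak := (@normal_peak R 1).

Definition normal_cdf t : R := \int[mu]_(x in `]-oo, t]) phi x.
Local Notation Phi := normal_cdf.

Lemma normal_prob_Nyc t : normal_prob 0 1 `]-oo, t] = (Phi t)%:E.
Proof. by rewrite fineK// (@fin_num_measure _ _ _ (normal_prob 0 1)). Qed.

Lemma std_normal_pdfE x : phi x = peak * expR (- x ^+ 2 / 2).
Proof. by rewrite normal_pdfE ?oner_eq0// /normal_fun subr0 expr1n. Qed.

Lemma std_normal_pdfN x : phi (- x) = phi x.
Proof. by rewrite !std_normal_pdfE sqrrN. Qed.

#[global] Instance is_derive_std_normal_pdf x : is_derive x 1 phi (- x * phi x).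
Proof.
rewrite (_ : phi = fun x => peak * expR (- x ^+ 2 / 2)); last first.
  by apply/funext => y; exact: std_normal_pdfE.
apply: is_derive_eq.
by rewrite /GRing.scale/= /GRing.scale/=; field.
Qed.

#[global] Instance is_derive_normal_cdf x : is_derive x 1 Phi (phi x).
Proof.
have [||||dPhi <-] := @continuous_FTC1 _ phi -oo%O x (x + 1).
- by rewrite ltrDl.
- by apply: integrableS (integrable_normal_pdf 0 1).
- by rewrite ltNyr.
- exact/continuous_normal_pdf/oner_neq0.
by rewrite derive1E; exact/derivableP.
Qed.

(** The identity seen as a random variable under [normal_prob 0 1]; its distribution function is
    [Phi], which gives the limit at infinity. *)
Let idTR : measurableTypeR R -> R := idfun.

#[local] HB.instance Definition _ :=
  @isMeasurableFun.Build _ _ _ _ idTR (@measurable_id _ _ setT).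

Lemma cvg_normal_cdfy : Phi x @[x --> +oo] --> (1 : R).
Proof.
apply/fine_cvg.
have := @cvg_cdfy1 _ _ _ (normal_prob 0 1) (idTR : {RV normal_prob 0 1 >-> R}).
exact.
Qed.

Lemma continuous_normal_cdf : continuous Phi.
Proof. exact: is_derive_continuous is_derive_normal_cdf. Qed.

Lemma continuous_std_normal_pdf : continuous phi.
Proof. exact: is_derive_continuous is_derive_std_normal_pdf. Qed.

Let mphi (D : set R) : measurable_fun D (fun x : R => (phi x)%:E).
Proof.
by apply/measurable_EFinP; apply: measurable_funTS; exact: measurable_normal_pdf.
Qed.

Lemma normal_prob_Nyo t : normal_prob 0 1 `]-oo, t[ = (Phi t)%:E.
Proof. by rewrite -normal_prob_Nyc; apply: integral_itv_bndo_bndc. Qed.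

Lemma normal_prob_cy t : normal_prob 0 1 `[t, +oo[ = (1 - Phi t)%:E.
Proof.
rewrite EFinB -normal_prob_Nyo -(@probability_setC _ _ _ (normal_prob 0 1))//.
by rewrite setCitvl.
Qed.

Lemma normal_cdfN t : Phi (- t) = 1 - Phi t.
Proof.
apply: EFin_inj; rewrite -normal_prob_cy -normal_prob_Nyc /normal_prob.
rewrite ge0_integration_by_substitutionNy.
- by apply: eq_integral => x _ /=; rewrite std_normal_pdfN.
- exact/continuous_subspaceT/continuous_std_normal_pdf.
- by move=> x _; exact: normal_pdf_ge0.
Qed.

Lemma normal_cdf0 : Phi 0 = 1 / 2.
Proof. by have := normal_cdfN 0; rewrite oppr0; lra. Qed.

Lemma normal_cdf_le : {homo Phi : x y / x <= y}.
Proof.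
move=> x y xy; rewrite -lee_fin -!normal_prob_Nyc.
apply: (@le_measure _ _ _ (normal_prob 0 1)); rewrite ?inE//.
by apply: subset_itvl; rewrite bnd_simp.
Qed.

Lemma normal_cdf_le1 t : Phi t <= 1.
Proof.
by rewrite -lee_fin -normal_prob_Nyc (@probability_le1 _ _ _ (normal_prob 0 1)).
Qed.

Lemma normal_cdf_ge_half t : 0 <= t -> 1 / 2 <= Phi t.
Proof. by move=> t0; rewrite -normal_cdf0 normal_cdf_le. Qed.

Lemma normal_prob_cc t : 0 <= t -> normal_prob 0 1 `[- t, t] = (2 * Phi t - 1)%:E.
Proof.
move=> t0; have -> : `[- t, t]%classic = `]-oo, t] `\` `]-oo, - t[ :> set R.
  by rewrite -[RHS]setCK setCD setCitvl setUC -[LHS]setCK setCitv.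
rewrite (@measureD _ _ _ (normal_prob 0 1))//; last first.
  by rewrite ltey_eq (@fin_num_measure _ _ _ (normal_prob 0 1)).
rewrite setIidr; last by apply: subset_itvl; rewrite bnd_simp; lra.
rewrite [X in (X - _)%E]normal_prob_Nyc [X in (_ - X)%E]normal_prob_Nyo -EFinB.
by rewrite normal_cdfN; congr EFin; ring.
Qed.

Lemma cvg_std_normal_pdfy : phi x @[x --> +oo] --> (0 : R).
Proof.
rewrite (_ : phi = fun x => peak * expR (- (x ^+ 2 / 2))); last first.
  by apply/funext => y; rewrite std_normal_pdfE mulNr.
rewrite -[X in _ --> X](mulr0 peak); apply: cvgM; first exact: cvg_cst.
apply: (cvg_comp (fun x => x ^+ 2 / 2) (fun x => expR (- x))).
  by apply: gt0_cvgMly; [rewrite invr_gt0|exact: cvgr_expr2].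
exact: cvgr_expR.
Qed.

(** On [[t, +oo[] one has [t * phi x <= x * phi x], and [x * phi x] has the antiderivative [- phi].
    The bound makes boundary terms at infinity vanish. *)
Lemma mills_ratio_le t : 0 <= t -> t * (1 - Phi t) <= phi t.
Proof.
move=> t0.
have xphi : (\int[mu]_(x in `[t, +oo[) (x * phi x)%:E = (phi t)%:E)%E.
  rewrite -[phi t]opprK -[- - _]sub0r.
  apply: (@ge0_is_derive_FTC2y _ _ (fun x => - phi x)).
  - by move=> x tx; rewrite mulr_ge0 ?normal_pdf_ge0 ?(le_trans t0).
  - move=> x; apply: continuousM; first exact: cvg_id.
    exact: continuous_std_normal_pdf.
  - by move=> x; apply: is_derive_eq; rewrite mulNr opprK.
  - by rewrite -[X in _ --> X]oppr0; apply: cvgN; exact: cvg_std_normal_pdfy.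
rewrite -lee_fin -xphi EFinM -normal_prob_cy /normal_prob -ge0_integralZl//.
- apply: ge0_le_integral => //.
  + by move=> x _; rewrite mule_ge0// lee_fin normal_pdf_ge0.
  + by apply: emeasurable_funM => //; exact: mphi.
  + by apply/measurable_EFinP/measurable_funTS/measurable_funM => //; exact: measurable_normal_pdf.
  + move=> x /=; rewrite in_itv/= andbT => tx.
    by rewrite -EFinM lee_fin ler_wpM2r// normal_pdf_ge0.
- exact: mphi.
- by move=> x _; rewrite lee_fin normal_pdf_ge0.
Qed.

Lemma cvg_mills : x * (1 - Phi x) @[x --> +oo] --> (0 : R).
Proof.
apply: (@squeeze_cvgr _ _ _ _ (cst 0) phi).
- near=> x; have x0 : 0 <= x by near: x; apply: nbhs_pinfty_ge; exact: num_real.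
  by rewrite mills_ratio_le// mulr_ge0// subr_ge0 normal_cdf_le1.
- exact: cvg_cst.
- exact: cvg_std_normal_pdfy.
Unshelve. all: by end_near. Qed.

(** Integration by parts yields the antiderivative [F], which tends to 0 at infinity and equals
    [- peak] at 0. *)
Lemma integral0y_normal_tail :
  (\int[mu]_(x in `[0%R, +oo[) (1 - Phi x)%:E = peak%:E)%E.
Proof.
pose F x := x * (1 - Phi x) - phi x.
have -> : peak = 0 - F 0.
  rewrite /F mul0r !sub0r opprK std_normal_pdfE expr0n/= oppr0 mul0r.
  by rewrite expR0 mulr1.
apply: ge0_is_derive_FTC2y.
- by move=> x _; rewrite subr_ge0 normal_cdf_le1.
- move=> x; apply: continuousB; first exact: cvg_cst.
  exact: continuous_normal_cdf.
- by move=> x; apply: is_derive_eq; rewrite /GRing.scale/=; ring.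
- rewrite -[X in _ --> X](subr0 0); apply: cvgB; first exact: cvg_mills.
  exact: cvg_std_normal_pdfy.
Qed.

(* The last term of the antiderivative comes from
   [phi x ^+ 2 = peak * phi (sqrt 2 * x)]. *)
Lemma integral0y_normal_cdf_tail :
  (\int[mu]_(x in `[0%R, +oo[) (Phi x * (1 - Phi x))%:E =
   (peak / Num.sqrt 2)%:E)%E.
Proof.
pose r : R := Num.sqrt 2.
have r2 : r ^+ 2 = 2 by rewrite sqr_sqrtr.
have r0 : 0 < r by rewrite sqrtr_gt0.
rewrite -/r.
(* The derivative of the first term is the integrand plus [x * phi x * (1 - 2 * Phi x)]. The second
   term cancels this surplus and leaves [- 2 * phi x ^+ 2], which the third one compensates. *)
pose F x := Phi x * (x * (1 - Phi x)) + phi x * (1 - 2 * Phi x)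
  + r * peak * Phi (r * x).
(* The limit of [F] is [r * peak] and [F 0] is half of it; [r ^+ 2 = 2] turns [r / 2] into
   [1 / r]. *)
have -> : peak / r = r * peak - F 0.
  rewrite /F mulr0 normal_cdf0 (_ : r * peak - _ = r * peak / 2); last by field.
  by rewrite -r2; field; rewrite gt_eqF.
apply: ge0_is_derive_FTC2y.
- move=> x x0; rewrite mulr_ge0 ?subr_ge0 ?normal_cdf_le1//.
  by apply: le_trans (normal_cdf_ge_half x0); lra.
- move=> x; apply: continuousM; first exact: continuous_normal_cdf.
  apply: continuousB; first exact: cvg_cst.
  exact: continuous_normal_cdf.
- move=> x; apply: is_derive_eq; rewrite /GRing.scale/=.
  have phi2 : peak * phi (r * x) = phi x ^+ 2.
    rewrite !std_normal_pdfE !exprMn -expRM_natl r2 mulrA -expr2; congr (_ * expR _).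
    by field.
  rewrite [X in _ + X = _](_ : _ = r ^+ 2 * (peak * phi (r * x))); last by ring.
  by rewrite phi2 r2; ring.
- rewrite [X in _ --> X](_ : _ = 1 * 0 + 0 * (1 - 2 * 1) + r * peak * 1); last ring.
  apply: cvgD; first apply: cvgD; apply: cvgM.
  + exact: cvg_normal_cdfy.
  + exact: cvg_mills.
  + exact: cvg_std_normal_pdfy.
  + apply: cvgB; first exact: cvg_cst.
    by apply: cvgM; [exact: cvg_cst|exact: cvg_normal_cdfy].
  + exact: cvg_cst.
  + apply: (cvg_comp (fun x => r * x) Phi); last exact: cvg_normal_cdfy.
    rewrite (_ : *%R r = fun x => x * r); last by apply/funext => x; rewrite mulrC.
    by apply: gt0_cvgMly => //; exact: cvg_id.
Qed.

End normal_cdf.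

(** * Expectations of maxima through tail probabilities *)

Section tail_formulas.
Local Open Scope classical_set_scope.
Context d (T : measurableType d) (R : realType) (P : probability T R).
Local Notation mu := (@lebesgue_measure R).
Implicit Types (f : T -> R) (r : R).

Lemma ge0_integral_tail f : measurable_fun setT f -> (forall w, 0 <= f w) ->
  (\int[P]_w (f w)%:E = \int[mu]_(r in `[0%R, +oo[) P [set w | (r < f w)%R])%E.
Proof.
move=> mf f0; pose X : {RV P >-> R} := mfun_Sub (mem_set mf).
have := @ge0_expectation_ccdf _ _ _ P X f0; rewrite unlock => ->.
apply: eq_integral => r _; rewrite /ccdf /distribution /pushforward; congr (P _).
by apply/seteqP; split => w /=; rewrite in_itv/= andbT.
Qed.

(** The tail formula is applied to the positive and the negative part; for [r >= 0] the truncation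
    at 0 does not change the events. *)
Lemma integral_tails f : measurable_fun setT f ->
  (\int[P]_w (f w)%:E = \int[mu]_(r in `[0%R, +oo[) P [set w | (r < f w)%R]
    - \int[mu]_(r in `[0%R, +oo[) P [set w | (f w < - r)%R])%E.
Proof.
move=> mf; rewrite integralE; congr (_ - _)%E.
- under eq_integral do rewrite funeposE -EFin_max.
  rewrite ge0_integral_tail//; last 2 first.
  + exact: measurable_maxr.
  + by move=> w; rewrite le_max lexx orbT.
  apply: eq_integral => r; rewrite inE/= in_itv/= andbT => r0; congr (P _).
  by apply/seteqP; split => w /=; rewrite lt_max (ltNge r 0) r0 orbF.
- under eq_integral do rewrite funenegE -EFinN -EFin_max.
  rewrite ge0_integral_tail//; last 2 first.
  + by apply: measurable_maxr => //; exact: measurableT_comp.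
  + by move=> w; rewrite le_max lexx orbT.
  apply: eq_integral => r; rewrite inE/= in_itv/= andbT => r0; congr (P _).
  by apply/seteqP; split => w /=; rewrite lt_max (ltNge r 0) r0 orbF ltrNr.
Qed.

Lemma Emax_tails m (f : nat -> T -> R) : (0 < m)%N ->
  (forall i, measurable_fun setT (f i)) ->
  (Emax P m f =
    \int[mu]_(r in `[0%R, +oo[) P (~` [set w | forall i, (i < m)%N -> (f i w <= r)%R])
    - \int[mu]_(r in `[0%R, +oo[) P [set w | forall i, (i < m)%N -> (f i w < - r)%R])%E.
Proof.
move=> m0 mf; pose M w := \big[Order.max/-oo%E]_(0 <= i < m) (f i w)%:E.
have M_le w r : (M w <= r%:E)%E <-> forall i, (i < m)%N -> f i w <= r.
  rewrite /M big_mkord; split=> [/bigmax_leP[_ h] i im|h].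
    by have := h (Ordinal im) isT; rewrite lee_fin.
  by apply/bigmax_leP; split=> [|i _]; rewrite ?leNye// lee_fin h.
have M_lt w r : (M w < r%:E)%E <-> forall i, (i < m)%N -> f i w < r.
  rewrite /M big_mkord; split=> [/bigmax_ltP[_ h] i im|h].
    by have := h (Ordinal im) isT; rewrite lte_fin.
  by apply/bigmax_ltP; split=> [|i _]; rewrite ?ltNyr// lte_fin h.
(* As [0 < m], the maximum dominates [f 0 w], so the initial value [-oo] never survives. *)
have Mfin w : M w = (fine (M w))%:E.
  rewrite fineK// fin_numElt; apply/andP; split.
    rewrite ltNge; apply/negP => MNy.
    have /M_lt/(_ _ m0) : (M w < (f 0 w)%:E)%E by rewrite (le_lt_trans MNy)// ltNyr.
    by rewrite ltxx.
  by rewrite /M big_mkord; apply/bigmax_ltP; split=> [|i _]; rewrite ?ltry.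
have mM : measurable_fun setT M.
  rewrite /M; elim: {m0 M M_le M_lt Mfin} m => [|m IHm].
    rewrite (_ : (fun _ => _) = cst -oo%E); first exact: measurable_cst.
    by apply/funext => w; rewrite big_nil.
  rewrite (_ : (fun _ => _) = fun w =>
      maxe (\big[maxe/-oo%E]_(0 <= i < m) (f i w)%:E) (f m w)%:E); last first.
    by apply/funext => w; rewrite big_nat_recr.
  by apply: measurable_maxe => //; exact/measurable_EFinP/mf.
transitivity (\int[P]_w (fine (M w))%:E)%E; first by apply: eq_integral => w _; rewrite -Mfin.
rewrite integral_tails; last exact: measurableT_comp.
congr (_ - _)%E; apply: eq_integral => r _; congr (P _).
- apply/seteqP; split => w /=; rewrite -lte_fin -Mfin.
    by move=> + /M_le; rewrite leNgt => ->.
  by rewrite ltNge => /M_le/negP.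
- by apply/seteqP; split => w /=; rewrite -lte_fin -Mfin => /M_lt.
Qed.

(** Independence is applied to the set [J] of the first [k] indices, so that independence of the
    [2n] variables also covers the maximum of the first [n] absolute values. *)
Lemma independent_all m (X : nat -> {RV P >-> R}) k (A : set R) (p : R) :
  mutually_independent P m X -> (k <= m)%N -> measurable A ->
  (forall i, (i < k)%N -> P (X i @^-1` A) = p%:E) ->
  P [set w | forall i, (i < k)%N -> A (X i w)] = (p ^+ k)%:E.
Proof.
move=> iX km mA PA; pose J := [set i : 'I_m | (i < k)%N]%SET.
have J_mem (w : T) : (\big[setI/setT]_(i in J) (X i @^-1` A)) w <->
    forall i, (i < k)%N -> A (X i w).
  rewrite -bigcap_seq_cond; split => /= [h i ik|h i].
    apply: (h (Ordinal (leq_trans ik km))) => /=.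
    by rewrite mem_index_enum inE.
  by rewrite /= inE => /andP[_ ik]; exact: h.
rewrite (_ : mkset _ = \big[setI/setT]_(i in J) (X i @^-1` A)); last first.
  by apply/seteqP; split => w /J_mem.
rewrite (iX J (fun=> A))// (eq_bigr (fun=> p%:E)); last first.
  by move=> i; rewrite inE; exact: PA.
rewrite prodEFin prodr_const; congr (_ ^+ _)%:E.
rewrite -sum1_card (eq_bigl (fun i : 'I_m => (i < k)%N)); last first.
  by move=> i; rewrite inE.
by rewrite (big_ord_narrow km) big_const_ord iter_addn mul1n addn0.
Qed.

End tail_formulas.

(** * The two Gaussian expectations as integrals of powers of [Phi] *)

Section gaussian_maxima.
Local Open Scope classical_set_scope.
Context d (T : measurableType d) (R : realType) (P : probability T R).
Local Notation mu := (@lebesgue_measure R).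
Local Notation Phi := (@normal_cdf R).
Implicit Types (r u : R).

Variables (m : nat) (X : nat -> {RV P >-> R}).
Hypothesis iX : mutually_independent P m X.
Hypothesis gX : forall i, (i < m)%N -> standard_gaussian P (X i).

Let gaussian_all k (A : set R) (p : R) : (k <= m)%N -> measurable A ->
  normal_prob 0 1 A = p%:E ->
  P [set w | forall i, (i < k)%N -> A (X i w)] = (p ^+ k)%:E.
Proof.
move=> km mA pA; apply: (independent_all iX) => // i ik.
by rewrite -pA -(gX (leq_trans ik km)).
Qed.

Let gaussian_allC k (A : set R) (p : R) : (k <= m)%N -> measurable A ->
  normal_prob 0 1 A = p%:E ->
  P (~` [set w | forall i, (i < k)%N -> A (X i w)]) = (1 - p ^+ k)%:E.
Proof.
move=> km mA pA; rewrite probability_setC ?(gaussian_all km mA pA) ?EFinB//.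
rewrite (_ : mkset _ = \bigcap_(i in [set i | (i < k)%N]) (X i @^-1` A))//.
by apply: bigcap_measurableType => // i _; exact: measurable_funPTI.
Qed.

Lemma gaussian_Emax : (0 < m)%N ->
  (Emax P m X = \int[mu]_(r in `[0%R, +oo[) (1 - Phi r ^+ m)%:E
    - \int[mu]_(r in `[0%R, +oo[) ((1 - Phi r) ^+ m)%:E)%E.
Proof.
move=> m0; rewrite Emax_tails//.
congr (_ - _)%E; apply: eq_integral => r _.
- by apply: (@gaussian_allC m `]-oo, r]); rewrite ?normal_prob_Nyc.
- by apply: (@gaussian_all m `]-oo, - r[); rewrite ?normal_prob_Nyo ?normal_cdfN.
Qed.

Lemma gaussian_Emax_norm n : (0 < n <= m)%N ->
  (Emax P n (fun i w => `|X i w|%R) =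
    \int[mu]_(r in `[0%R, +oo[) (1 - (2 * Phi r - 1) ^+ n)%:E)%E.
Proof.
move=> /andP[n0 nm]; rewrite Emax_tails//; last first.
  by move=> i; exact: measurableT_comp.
rewrite [X in (_ - X)%E]integral0_eq ?sube0; last first.
  move=> r /=; rewrite in_itv/= andbT => r0.
  rewrite (_ : mkset _ = set0) ?measure0// -subset0 => w /(_ _ n0).
  by rewrite ltNge (le_trans _ (normr_ge0 _))// oppr_le0.
apply: eq_integral => r; rewrite inE/= in_itv/= andbT => r0.
rewrite -(@gaussian_allC n `[- r, r])// ?normal_prob_cc//.
by congr (P (~` _)); apply/seteqP; split => w /= h i /h; rewrite in_itv/= ler_norml.
Qed.

End gaussian_maxima.

(** * Comparison of the tail integrals *)

Section tail_comparison.
Local Open Scope classical_set_scope.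
Context {R : realType}.
Local Notation mu := (@lebesgue_measure R).
Local Notation Phi := (@normal_cdf R).
Implicit Types (r u : R) (m n : nat).

Let measurable_Phi (D : set R) : measurable_fun D Phi.
Proof.
by apply: measurable_funTS; apply: continuous_measurable_fun; exact: continuous_normal_cdf.
Qed.

Let Phi_bounds r : `[0%R, +oo[%classic r -> 1 / 2 <= Phi r <= 1.
Proof.
by rewrite /= in_itv/= andbT => r0; rewrite normal_cdf_ge_half ?normal_cdf_le1.
Qed.

Let expr_le u m : 0 <= u -> u <= 1 -> (0 < m)%N -> u ^+ m <= u.
Proof.
by case: m => // m u0 u1 _; rewrite exprS ler_piMr// exprn_ile1.
Qed.

Let two_sided_ge0 u m : 0 <= u -> u <= 1 -> (0 < m)%N ->
  0 <= 1 - u ^+ m - (1 - u) ^+ m.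
Proof.
move=> u0 u1 m0; have := expr_le u0 u1 m0.
have q0 : 0 <= 1 - u by lra.
have q1 : 1 - u <= 1 by lra.
by have := expr_le q0 q1 m0; lra.
Qed.

Let measurable_tail (D : set R) : measurable_fun D (fun r : R => 1 - Phi r).
Proof. exact: measurable_funB. Qed.

Let measurable_norm_tail (D : set R) n :
  measurable_fun D (fun r : R => (1 - (2 * Phi r - 1) ^+ n)%:E).
Proof.
apply/measurable_EFinP; apply: measurable_funB => //; apply: measurable_funX.
by apply: measurable_funB => //; exact: measurable_funM.
Qed.

Let measurable_two_sided (D : set R) m :
  measurable_fun D (fun r : R => (1 - Phi r ^+ m - (1 - Phi r) ^+ m)%:E).
Proof.
apply/measurable_EFinP; apply: measurable_funB; last first.
  by apply: measurable_funX; exact: measurable_funB.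
by apply: measurable_funB => //; exact: measurable_funX.
Qed.

(** The integrand is at most [1 - Phi r], whose integral is the finite peak value. Finiteness lets
    this integral be cancelled or moved across inequalities in the extended reals. *)
Lemma integral_normal_tailX_fin_num m : (0 < m)%N ->
  (\int[mu]_(r in `[0%R, +oo[) ((1 - Phi r) ^+ m)%:E)%E \is a fin_num.
Proof.
move=> m0; rewrite ge0_fin_numE; last first.
  apply: integral_ge0 => r /Phi_bounds/andP[_ r1].
  by rewrite lee_fin exprn_ge0// subr_ge0.
apply: le_lt_trans (ltry (normal_peak 1)); rewrite -integral0y_normal_tail.
apply: ge0_le_integral => //.
- by move=> r /Phi_bounds/andP[_ r1]; rewrite lee_fin exprn_ge0// subr_ge0.
- by apply/measurable_EFinP; apply: measurable_funX; exact: measurable_tail.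
- by apply/measurable_EFinP; exact: measurable_tail.
- by move=> r /Phi_bounds/andP[? ?]; rewrite lee_fin expr_le//; lra.
Qed.

(** The first integral is split as the sum of the right-hand side and the second integral, which is
    finite and cancels. *)
Lemma integral_normal_two_sided m : (0 < m)%N ->
  (\int[mu]_(r in `[0%R, +oo[) (1 - Phi r ^+ m)%:E
    - \int[mu]_(r in `[0%R, +oo[) ((1 - Phi r) ^+ m)%:E
  = \int[mu]_(r in `[0%R, +oo[) (1 - Phi r ^+ m - (1 - Phi r) ^+ m)%:E)%E.
Proof.
move=> m0.
rewrite [X in (X - _)%E](_ : _ =
    (\int[mu]_(r in `[0%R, +oo[) (1 - Phi r ^+ m - (1 - Phi r) ^+ m)%:E
    + \int[mu]_(r in `[0%R, +oo[) ((1 - Phi r) ^+ m)%:E)%E); last first.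
  rewrite -ge0_integralD//.
  - by apply: eq_integral => r _; rewrite -EFinD subrK.
  - by move=> r /Phi_bounds/andP[? ?]; rewrite lee_fin two_sided_ge0//; lra.
  - exact: measurable_two_sided.
  - by move=> r /Phi_bounds/andP[_ ?]; rewrite lee_fin exprn_ge0// subr_ge0.
  - by apply/measurable_EFinP; apply: measurable_funX; exact: measurable_tail.
by rewrite addeK// integral_normal_tailX_fin_num.
Qed.

Lemma integral_normal_max_le_norm n :
  (\int[mu]_(r in `[0%R, +oo[) (1 - Phi r ^+ (2 * n))%:E
  <= \int[mu]_(r in `[0%R, +oo[) (1 - (2 * Phi r - 1) ^+ n)%:E)%E.
Proof.
apply: ge0_le_integral => //.
- move=> r /Phi_bounds/andP[? ?]; rewrite lee_fin subr_ge0 exprn_ile1//; lra.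
- apply/measurable_EFinP; apply: measurable_funB => //; apply: measurable_funX.
  exact: measurable_Phi.
- exact: measurable_norm_tail.
- move=> r /Phi_bounds/andP[? ?]; rewrite lee_fin lerD2l lerN2 exprM lerXn2r//.
  + by rewrite nnegrE; lra.
  + by rewrite nnegrE sqr_ge0.
  + have := sqr_ge0 (Phi r - 1).
    by rewrite (_ : (Phi r - 1) ^+ 2 = Phi r ^+ 2 - (2 * Phi r - 1)) ?subr_ge0//; ring.
Qed.

Lemma integral_normal_norm_le_max n : (0 < n)%N ->
  (\int[mu]_(r in `[0%R, +oo[) (1 - (2 * Phi r - 1) ^+ n)%:E
  <= (Num.sqrt ((2 * n)%:R / (2 * n - 1)%:R))%:E *
     \int[mu]_(r in `[0%R, +oo[) (1 - Phi r ^+ (2 * n) - (1 - Phi r) ^+ (2 * n))%:E)%E.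
Proof.
move=> n0; rewrite -ge0_integralZl//; last 2 first.
- exact: measurable_two_sided.
- move=> r /Phi_bounds/andP[? ?]; rewrite lee_fin two_sided_ge0//; [lra|lia].
case: n n0 => [//|[_|n _]].
  (* For [n = 1] the integrands are [2 * (1 - Phi)] and, up to the constant [Num.sqrt 2],
     [2 * Phi * (1 - Phi)]; both sides evaluate to twice the peak. *)
  have s0 : (0 : R) < Num.sqrt 2 by rewrite sqrtr_gt0.
  rewrite (_ : (\int[_]_(r in _) _)%E =
    (2 * \int[mu]_(r in `[0%R, +oo[) (1 - Phi r)%:E)%E); last first.
    rewrite -ge0_integralZl//.
    - by apply: eq_integral => r _; rewrite -EFinM; congr EFin; ring.
    - by apply/measurable_EFinP; exact: measurable_tail.
    - by move=> r /Phi_bounds/andP[? ?]; rewrite lee_fin; lra.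
  rewrite integral0y_normal_tail.
  rewrite [leRHS](_ : _ = ((2 * Num.sqrt 2)%:E *
    \int[mu]_(r in `[0%R, +oo[) (Phi r * (1 - Phi r))%:E)%E); last first.
    rewrite -ge0_integralZl//.
    - apply: eq_integral => r _; rewrite -!EFinM; congr EFin.
      by rewrite divr1; ring.
    - apply/measurable_EFinP; apply: measurable_funM; last exact: measurable_tail.
      exact: measurable_Phi.
    - move=> r /Phi_bounds/andP[? ?]; rewrite lee_fin mulr_ge0 ?subr_ge0//; lra.
  rewrite integral0y_normal_cdf_tail -!EFinM lee_fin.
  rewrite (_ : 2 * Num.sqrt 2 * _ = 2 * normal_peak 1) ?lexx//.
  by field; rewrite gt_eqF.
apply: ge0_le_integral => //.
- by move=> r /Phi_bounds/andP[? ?]; rewrite lee_fin subr_ge0 exprn_ile1//; lra.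
- exact: measurable_norm_tail.
- by apply: emeasurable_funM => //; exact: measurable_two_sided.
- by move=> r /Phi_bounds/andP[? ?]; rewrite -EFinM lee_fin abs_max_tail_le.
Qed.

End tail_comparison.
Unset Implicit Arguments.

Theorem theorem2p1 (d : measure_display) (T : measurableType d) (R : realType)
    (P : probability T R) (n : nat) (eta : nat -> {RV P >-> R}) :
  (1 <= n)%N ->
  mutually_independent P (2 * n) eta ->
  (forall i, (i < 2 * n)%N -> standard_gaussian P (eta i)) ->
  (Emax P (2 * n) (fun i => eta i) <= Emax P n (fun i w => `|eta i w|%R)
   /\ Emax P n (fun i w => `|eta i w|%R)
      <= (Num.sqrt ((2 * n)%:R / (2 * n - 1)%:R))%:E * Emax P (2 * n) (fun i => eta i))%E.
Proof.
move=> n0 ieta geta.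
have n20 : (0 < 2 * n)%N by rewrite muln_gt0.
have nle : (0 < n <= 2 * n)%N by rewrite n0 leq_pmull.
have -> := gaussian_Emax ieta geta n20.
have -> := gaussian_Emax_norm ieta geta nle.
split; last by rewrite integral_normal_two_sided// integral_normal_norm_le_max.
(* The subtracted negative tail is moved to the right, where it is a nonnegative extra term. *)
rewrite leeBlDr ?integral_normal_tailX_fin_num//.
apply: (le_trans (integral_normal_max_le_norm n)); rewrite leeDl//.
apply: integral_ge0 => r _.
by rewrite lee_fin exprn_ge0// subr_ge0 normal_cdf_le1.
Qed.
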